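(* Let $H\in\mathbb{N}$, $\alpha\in\mathbb{R}$, $\gamma\in(0,\infty)$. Let $\|\phi\|=[\sum_{i=1}^{3H+1}|\phi_i|^2]^{1/2}$ for $\phi=(\phi_1,\dots,\phi_{3H+1})\in\mathbb{R}^{3H+1}$. For $r\in[1,\infty)$ and $x\in\mathbb{R}$ let $\sigma_r(x)=r^{-1}\ln(1+r^{-1}e^{rx})$, and let $\sigma_\infty(x)=\max\{x,0\}$. For $r\in[1,\infty]$, $\phi=(\phi_1,\dots,\phi_{3H+1})\in\mathbb{R}^{3H+1}$, $x\in\mathbb{R}$ let $$\mathscr{N}_r^{\phi}(x)=\phi_{3H+1}+\sum_{j=1}^{H}\phi_{2H+j}\,\sigma_r(\phi_j x+\phi_{H+j}),\qquad \mathcal{L}_r(\phi)=\int_0^1(\mathscr{N}_r^{\phi}(y)-\alpha)^2\,dy .$$ Let $\mathcal{G}=(\mathcal{G}_1,\dots,\mathcal{G}_{3H+1})\colon\mathbb{R}^{3H+1}\to\mathbb{R}^{3H+1}$ be a function which satisfies, for all $\phi\in\{\varphi\in\mathbb{R}^{3H+1}\colon ((\nabla\mathcal{L}_r)(\varphi))_{r\in\mathbb{N}}\text{ is convergent}\}$, that $\mathcal{G}(\phi)=\lim_{r\to\infty}(\nabla\mathcal{L}_r)(\phi)$. Let $\Theta=(\Theta_n)_{n\in\mathbb{N}_0}\colon\mathbb{N}_0\to\mathbb{R}^{3H+1}$ satisfy for all $n\in\mathbb{N}_0$ that $\Theta_{n+1}=\Theta_n-\gamma\,\mathcal{G}(\Theta_n)$,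 and assume $\gamma\le(4\|\Theta_0\|+6|\alpha|+2)^{-2}$. Then (i) for all $\phi\in\mathbb{R}^{3H+1}$ at which $\mathcal{L}_\infty$ is differentiable it holds that $(\nabla\mathcal{L}_\infty)(\phi)=\mathcal{G}(\phi)$; (ii) $\sup_{n\in\mathbb{N}_0}\|\Theta_n\|<\infty$; and (iii) $\limsup_{n\to\infty}\mathcal{L}_\infty(\Theta_n)=0$.
   Context: $\mathbb{N}=\{1,2,3,\dots\}$ and $\mathbb{N}_0=\{0,1,2,\dots\}$. All objects are defined in the claim. *)

(* Defs.v *)
From HB Require Import structures.
From mathcomp Require Import all_boot all_order all_algebra.
From mathcomp Require Import all_classical all_reals all_analysis.
Set Implicit Arguments.
Unset Strict Implicit.
Unset Printing Implicit Defensive.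
Import Order.TTheory GRing.Theory Num.Theory.
Import numFieldNormedType.Exports.
Local Open Scope classical_set_scope.
Local Open Scope ring_scope.

(* The library norm on row vectors is the sup norm; it induces the same
   topology and the same notion of differentiability as this one. *)
Definition euclidean_norm (R : realType) (n : nat) (v : 'rV[R]_n) : R :=
  Num.sqrt (\sum_(i < n) `|v 0 i| ^+ 2).

Definition gradient (R : realType) (n : nat) (f : 'rV[R]_n.+1 -> R)
    (v : 'rV[R]_n.+1) : 'rV[R]_n.+1 :=
  \row_(i < n.+1) 'D_(delta_mx 0 i) f v.

(* Meant for 1 <= r <= +oo; the value at -oo is irrelevant. *)
Definition activation (R : realType) (r : \bar R) (x : R) : R :=
  match r with
  | EFin s => s^-1 * ln (1 + s^-1 * expR (s * x))
  | _ => Num.max x 0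
  end.

(* Coordinates are numbered from 0: phi_j, phi_(H+j), phi_(2H+j) for
   1 <= j <= H and phi_(3H+1) sit at positions j-1, H+j-1, 2H+j-1 and 3H.
   All arguments of inord are below its bound (3 * H).+1. *)
Definition network (R : realType) (H : nat) (r : \bar R)
    (phi : 'rV[R]_(3 * H).+1) (x : R) : R :=
  phi 0 ord_max +
  \sum_(j < H) phi 0 (inord (2 * H + j)) *
    activation r (phi 0 (inord j) * x + phi 0 (inord (H + j))).

Definition risk (R : realType) (H : nat) (alpha : R) (r : \bar R)
    (phi : 'rV[R]_(3 * H).+1) : R :=
  \int[lebesgue_measure]_(y in `[0, 1]) (network r phi y - alpha) ^+ 2.

(* Main.v *)
Require Import Defs.
From HB Require Import structures.
From mathcomp Require Import all_boot all_order all_algebra.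
From mathcomp Require Import all_classical all_reals all_analysis.
From mathcomp Require Import measurable_realfun zify ring lra.
Set Implicit Arguments.
Unset Strict Implicit.
Unset Printing Implicit Defensive.
Import Order.TTheory GRing.Theory Num.Theory.
Import numFieldNormedType.Exports.
Local Open Scope classical_set_scope.
Local Open Scope ring_scope.

(** The smoothed activations have derivatives converging pointwise to the left
    derivative of the ReLU. The inputs lie in [0, 1], so decreasing one
    parameter can only decrease a pre-activation: left difference quotients of
    the ReLU risk converge to the limit of the smooth gradients at every
    parameter, by bounded convergence. This identifies G and gives (i).

    For the descent, let c be the output bias and
    V phi := |phi|^2 + (c - 2 alpha)^2. Since z * relu'(z) = relu(z), the
    derivative of the network N in the direction phi is 2 N - c, hence
    <grad V, G> = 8 L. Together with |G|^2 <= 4 L (1 + 2 |phi|^2), the bound on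
    the step size gives V(Theta_{n+1}) <= V(Theta_n) - 4 gamma L(Theta_n);
    so V bounds the iterates and the series of the L(Theta_n) converges. *)

(** * Integration of bounded measurable functions over the unit interval *)

Section UnitIntervalIntegral.
Context {R : realType}.
Implicit Types (f g : R -> R) (I : finType).

Let mu := @lebesgue_measure R.

(** Unlike integrability, this condition is stable under products, so every integrand below is
    handled by closure rules alone. The bound is required on [[0, 1]] only. *)
Definition bounded_measurable f :=
  measurable_fun `[(0:R), 1] f /\
  exists M : R, forall y : R, 0 <= y <= 1 -> `|f y| <= M.

Lemma bounded_measurableD f g : bounded_measurable f -> bounded_measurable g ->
  bounded_measurable (fun y => f y + g y).
Proof.
move=> [mf [M fM]] [mg [N gN]]; split; first exact: measurable_funD.
exists (M + N) => y y01; rewrite (le_trans (ler_normD _ _))// lerD ?fM ?gN//.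
Qed.

Lemma bounded_measurableM f g : bounded_measurable f -> bounded_measurable g ->
  bounded_measurable (fun y => f y * g y).
Proof.
move=> [mf [M fM]] [mg [N gN]]; split; first exact: measurable_funM.
by exists (M * N) => y y01; rewrite normrM ler_pM ?fM ?gN.
Qed.

Lemma bounded_measurable_cst (c : R) : bounded_measurable (fun=> c).
Proof. by split => //; exists `|c|. Qed.

Lemma bounded_measurable_id : bounded_measurable id.
Proof.
split; first exact: measurable_id.
by exists 1 => y /andP[y0 y1]; rewrite ger0_norm.
Qed.

Lemma bounded_measurable_sum I (F : I -> R -> R) :
  (forall i, bounded_measurable (F i)) ->
  bounded_measurable (fun y => \sum_i F i y).
Proof.
move=> bF; split; first by apply: measurable_sum => i; have [] := bF i.
exists (\sum_i sval (cid (bF i).2)) => y y01.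
rewrite (le_trans (ler_norm_sum _ _ _))// ler_sum// => i _.
by case: cid => /= M; exact.
Qed.

Lemma bounded_measurable_integrable f :
  bounded_measurable f -> mu.-integrable `[(0:R), 1] (EFin \o f).
Proof.
move=> [mf [M fM]]; apply: measurable_bounded_integrable => //.
  by rewrite /mu/= lebesgue_measure_itv/= lte01 oppr0 adde0 ltry.
exists M; split; first by rewrite num_real.
move=> N /ltW MN y /=; rewrite in_itv/= => y01.
by rewrite (le_trans (fM _ y01)).
Qed.

Definition integral01 f := \int[mu]_(y in `[0, 1]) f y.

Lemma eq_integral01 f g :
  (forall y : R, 0 <= y <= 1 -> f y = g y) -> integral01 f = integral01 g.
Proof.
by move=> fg; apply: eq_Rintegral => y; rewrite inE/= in_itv/= => /fg.
Qed.

Lemma integral01D f g : bounded_measurable f -> bounded_measurable g ->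
  integral01 (fun y => f y + g y) = integral01 f + integral01 g.
Proof. by move=> bf bg; apply: RintegralD => //; exact: bounded_measurable_integrable. Qed.

Lemma integral01Z c f : bounded_measurable f ->
  integral01 (fun y => c * f y) = c * integral01 f.
Proof. by move=> bf; apply: RintegralZl => //; exact: bounded_measurable_integrable. Qed.

Lemma integral01_cst (c : R) : integral01 (fun=> c) = c.
Proof.
rewrite /integral01 Rintegral_cst//= /mu/= lebesgue_measure_itv/= lte01 oppr0.
by rewrite adde0 mulr1.
Qed.

Lemma integral01_sum I (F : I -> R -> R) :
  (forall i, bounded_measurable (F i)) ->
  integral01 (fun y => \sum_i F i y) = \sum_i integral01 (F i).
Proof.
move=> bF; rewrite -!(big_enum _ _ predT)/=.
under eq_integral01 do rewrite -(big_enum _ _ predT)/=.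
elim: (enum I) => [|i s IHs].
  by rewrite big_nil; under eq_integral01 do rewrite big_nil; exact: integral01_cst.
rewrite big_cons -IHs -integral01D//.
  by apply: eq_integral01 => y _; rewrite big_cons.
split; first by apply: measurable_sum => j; have [] := bF j.
exists (\sum_(j <- s) sval (cid (bF j).2)) => y y01.
rewrite (le_trans (ler_norm_sum _ _ _))// ler_sum// => j _.
by case: cid => /= M; exact.
Qed.

Lemma le_integral01 f g : bounded_measurable f -> bounded_measurable g ->
  (forall y : R, 0 <= y <= 1 -> f y <= g y) -> integral01 f <= integral01 g.
Proof.
move=> bf bg fg; apply: le_Rintegral => //; exact: bounded_measurable_integrable.
Qed.

Lemma integral01_ge0 f : (forall y : R, 0 <= y <= 1 -> 0 <= f y) -> 0 <= integral01 f.
Proof. by move=> f0; apply: Rintegral_ge0 => y /=; rewrite in_itv/=; exact: f0. Qed.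

Lemma bounded_convergence (u : nat -> R -> R) f (M : R) :
  (forall n, measurable_fun `[(0:R), 1] (u n)) ->
  (forall n (y : R), 0 <= y <= 1 -> `|u n y| <= M) ->
  (forall y : R, 0 <= y <= 1 -> u n y @[n --> \oo] --> f y) ->
  integral01 (u n) @[n --> \oo] --> integral01 f.
Proof.
move=> mu_ uM uf.
have mf : measurable_fun `[(0:R), 1] f.
  by apply: (measurable_fun_cvg mu_) => y /=; rewrite in_itv/=; exact: uf.
have bf : bounded_measurable f.
  split => //; exists M => y y01.
  have ufy : `|u n y| @[n --> \oo] --> `|f y| by apply: cvg_norm; exact: uf.
  rewrite -(cvg_lim _ ufy)//; apply: limr_le; first exact: cvgP ufy.
  by near=> n; exact: uM.
have [|||||ig _] := @dominated_convergence _ _ R mu `[(0:R), 1]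
    (measurable_itv _) (fun n => EFin \o u n) (EFin \o f) (cst M%:E).
- by move=> n; apply/measurable_EFinP; exact: mu_.
- exact/measurable_EFinP.
- apply/aeW => y /=; rewrite in_itv/= => y01; apply/fine_cvgP; split.
    exact: nearW.
  exact: uf.
- exact/bounded_measurable_integrable/bounded_measurable_cst.
- by apply/aeW => y n /=; rewrite in_itv/= => y01; rewrite lee_fin; exact: uM.
rewrite -[X in _ --> X -> _]fineK; last exact: integrable_fin_num.
exact: fine_cvg.
Unshelve. all: by end_near. Qed.

End UnitIntervalIntegral.

(** * Softplus activations, their derivatives, and their limits *)

Section Activation.
Context {R : realType}.
Implicit Types (r : \bar R) (s x y z : R).

(* The left derivative when [r = +oo]; it is the limit of the derivatives at
   finite [r], including at the kink. *)
Definition activation_deriv r x : R :=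
  match r with
  | EFin s => expR (s * x) / (s + expR (s * x))
  | _ => (0 < x)%R%:R
  end.

(** For finite [r] the upper bound amounts to [1 + s^-1 * expR (s * y) <= expR (s * (y - x)) * (1 +
    s^-1 * expR (s * x))], true since [expR (s * (y - x)) >= 1]. The two inequalities provide
    monotonicity, hence measurability, and a Lipschitz constant independent of [r]. *)
Lemma activation_increment r x y : (1 <= r)%E -> x <= y ->
  0 <= activation r y - activation r x <= y - x.
Proof.
case: r => [s| |]//=; last
  by move=> _ xy; rewrite /Num.max; do 2 case: ltP => ?; apply/andP; split; lra.
rewrite lee_fin => s1 xy; have s0 : 0 < s by lra.
have e0 z : 0 < 1 + s^-1 * expR (s * z).
  by rewrite addr_gt0// mulr_gt0 ?invr_gt0 ?expR_gt0.
rewrite -mulrBr; apply/andP; split.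
  rewrite mulr_ge0 ?invr_ge0 ?(ltW s0)// subr_ge0 ler_ln ?posrE//.
  by rewrite lerD2l ler_pM2l ?invr_gt0// ler_expR ler_pM2l.
rewrite ler_pdivrMl// lerBlDr -[s * (y - x)]expRK -lnM ?posrE ?expR_gt0//.
rewrite ler_ln ?posrE ?mulr_gt0 ?expR_gt0//.
rewrite mulrDr mulr1 mulrCA -expRD mulrBr subrK lerD2r.
by rewrite -expR0 ler_expR -mulrBr mulr_ge0 ?(ltW s0)// subr_ge0.
Qed.

Lemma activation_lipschitz r x y : (1 <= r)%E ->
  `|activation r y - activation r x| <= `|y - x|.
Proof.
move=> r1; wlog xy : x y / x <= y.
  by move=> h; have [/h//|/ltW/h] := leP x y; rewrite distrC [leRHS]distrC.
have /andP[a0 a1] := activation_increment r1 xy.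
by rewrite !ger0_norm// subr_ge0.
Qed.

Lemma activation_measurable r : (1 <= r)%E -> measurable_fun setT (activation r).
Proof.
move=> r1; apply: nondecreasing_measurable => // x y xy.
by rewrite -subr_ge0; have /andP[] := activation_increment r1 xy.
Qed.

Lemma activation_deriv_bound r x : (1 <= r)%E -> 0 <= activation_deriv r x <= 1.
Proof.
case: r => [s| |]//= r1; last by case: ltP; rewrite ?lexx ler01.
have e0 := expR_gt0 (s * x); rewrite lee_fin in r1.
by rewrite divr_ge0 ?addr_ge0 ?ler_pdivrMr ?mul1r//; lra.
Qed.

Lemma activation_deriv_measurable r : (1 <= r)%E ->
  measurable_fun setT (activation_deriv r).
Proof.
move=> r1; apply: nondecreasing_measurable => // x y xy.
case: r r1 => [s| |]//=; last first.
  by move=> _; case: (ltP 0 x) => ?; case: (ltP 0 y) => //= ?; lra.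
rewrite lee_fin => s1; have ex := expR_gt0 (s * x); have ey := expR_gt0 (s * y).
rewrite ler_pdivrMr; last lra.
rewrite mulrAC ler_pdivlMr; last lra.
have : expR (s * x) <= expR (s * y) by rewrite ler_expR ler_pM2l//; lra.
by move: (expR _) (expR _) ex ey => a b *; nra.
Qed.

Lemma is_derive_activation s x : 1 <= s ->
  is_derive x 1 (activation s%:E) (activation_deriv s%:E x).
Proof.
move=> s1; have s0 : 0 < s by lra.
have e0 : 0 < 1 + s^-1 * expR (s * x).
  by rewrite addr_gt0// mulr_gt0 ?invr_gt0 ?expR_gt0.
have -> : activation s%:E =
    (fun y => s^-1 *: (@ln R \o (fun y => 1 + s^-1 *: (@expR R \o (fun y => s *: y)) y)) y).
  by apply/funext.
have de : is_derive x 1 (@expR R \o (fun y => s *: y)) (expR (s * x) * s).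
  apply: is_derive1_comp.
  by have := is_deriveZ s (is_derive_id x 1); rewrite /GRing.scale/= mulr1.
have dl : is_derive (1 + s^-1 * expR (s * x)) 1 (@ln R) (1 + s^-1 * expR (s * x))^-1.
  exact: is_derive1_ln.
have d1 : is_derive x 1 (fun y => 1 + s^-1 *: (@expR R \o (fun y => s *: y)) y)
    (s^-1 * (expR (s * x) * s)).
  by have := is_deriveD (is_derive_cst (1 : R) x 1) (is_deriveZ s^-1 de); rewrite add0r.
have dln : is_derive x 1 (@ln R \o (fun y => 1 + s^-1 *: (@expR R \o (fun y => s *: y)) y))
    ((1 + s^-1 * expR (s * x))^-1 * (s^-1 * (expR (s * x) * s))).
  exact: is_derive1_comp.
have := is_deriveZ s^-1 dln; congr is_derive.
rewrite /GRing.scale/=; move: e0; set e := expR _ => e0.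
have e1 : 0 < e by exact: expR_gt0.
by field; rewrite ?gt_eqF//; lra.
Qed.

(** For the ReLU, [0 <= a] and [h n < 0] make the increment [h n * a] nonpositive. Thus for
    [z <= 0], kink included, both values vanish, and for [z > 0] the shifted point eventually stays
    positive, so the quotient is eventually constant in both cases. *)
Lemma activation_difference_quotient r (z a : R) (h : nat -> R) : (1 <= r)%E ->
  h n @[n --> \oo] --> 0 -> (forall n, h n != 0) ->
  (r = +oo%E -> 0 <= a /\ forall n, h n < 0) ->
  (h n)^-1 * (activation r (z + h n * a) - activation r z) @[n --> \oo]
    --> activation_deriv r z * a.
Proof.
move=> r1 h0 hn0 hr; case: r r1 hr => [s| |]// r1 hr.
  (* When [a != 0] the increments [h n * a] are nonzero, so the quotient sought is [a] times the
     quotient of the activation with increment [h n * a]. *)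
  have [a0|a0] := eqVneq a 0.
    rewrite a0 mulr0; under eq_fun do rewrite mulr0 addr0 subrr mulr0.
    exact: cvg_cst.
  have [dz <-] := is_derive_activation z r1.
  have dP : k^-1 * (activation s%:E (k + z) - activation s%:E z) @[k --> 0^'] -->
      'D_1 (activation s%:E) z.
    move: dz; rewrite /derivable; apply: cvg_trans; apply: near_eq_cvg.
    by near=> k => /=; rewrite /GRing.scale/= mulr1.
  have ha0 : h n * a @[n --> \oo] --> 0 by rewrite -(mul0r a); exact: cvgMl.
  have ha_neq0 n : h n * a != 0 by rewrite mulf_neq0.
  have {}dP := (cvgr_dnbhsP _ _ _).1 dP (fun n => h n * a) (conj ha_neq0 ha0).
  apply: cvg_trans (cvgM dP (cvg_cst a (F := \oo))); apply: near_eq_cvg; near=> n => /=.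
  by rewrite [_ + z]addrC; set w := _ - _; field; rewrite a0 hn0.
have {hr} [a0 hneg] := hr erefl.
have za : z + h n * a @[n --> \oo] --> z.
  rewrite -[X in _ --> X]addr0 -[X in _ + X](mul0r a).
  by apply: cvgD; [exact: cvg_cst|exact: cvgMl].
rewrite /=; have [z0|z0] := ltP 0 z; last first.
  rewrite mul0r; apply: cvg_near_cst; near=> n.
  rewrite !max_r ?subrr ?mulr0//.
  by have := hneg n; nra.
rewrite mul1r; apply: cvg_near_cst; near=> n.
rewrite !max_l ?(ltW z0)//; first by rewrite addrAC subrr add0r mulKf.
by apply/ltW; near: n; exact: (cvgr_gt z).
Unshelve. all: by end_near. Qed.

(** Writing the parameter as [s = t ^+ 2] turns [ln z <= z - 1] into the rate
    [s^-1 * ln s <= 2 * t^-1]. This controls the error from below; the error from above is at most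
    [s^-1 * ln 2 <= t^-1]. *)
Lemma activation_dist t x : 1 <= t ->
  `|activation (t ^+ 2)%:E x - activation +oo%E x| <= 3 * t^-1.
Proof.
move=> t1; have t0 : 0 < t by lra.
have s0 : 0 < t ^+ 2 by rewrite exprn_gt0.
have s1 : 1 <= t ^+ 2 by rewrite exprn_ege1.
have tV : t * t^-1 = 1 by rewrite divff// gt_eqF.
have q0 : 0 < t^-1 by rewrite invr_gt0.
have q1 : t^-1 <= 1 by rewrite invf_le1.
have qE : (t ^+ 2)^-1 = t^-1 ^+ 2 by rewrite exprVn.
have ln_le z : 0 < z -> ln z <= z - 1.
  by move=> z0; have := @le_ln1Dx R (z - 1); rewrite [1 + _]addrC subrK; apply; lra.
have lns : (t ^+ 2)^-1 * ln (t ^+ 2) <= 2 * t^-1.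
  rewrite qE lnXn// -mulr_natl; have := ln_le _ t0.
  by move: (ln t) => l; move: (t^-1) tV q0 q1 => q *; nra.
have ln2 : (t ^+ 2)^-1 * ln (2 : R) <= t^-1.
  rewrite qE; have := ln_le 2 (ltr0Sn _ _); move: (ln 2) => l.
  by move: (t^-1) tV q0 q1 => q *; nra.
rewrite /activation; move: (t ^+ 2) s0 s1 lns ln2 {qE} => s s0 s1 lns ln2.
have sn0 : s != 0 by rewrite gt_eqF.
have sV0 : 0 < s^-1 by rewrite invr_gt0.
have sV1 : s^-1 <= 1 by rewrite invf_le1.
have e0 : 0 < s^-1 * expR (s * x) by rewrite mulr_gt0 ?expR_gt0.
set m := Num.max x 0.
have [mx m0] : x <= m /\ 0 <= m by rewrite /m !le_max !lexx orbT.
(* With [m] the ReLU value, both [1] and [expR (s * x)] are at most [expR (s * m)], so the argument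
   of the logarithm is at most [2 * expR (s * m)]. *)
have up : s^-1 * ln (1 + s^-1 * expR (s * x)) <= s^-1 * ln 2 + m.
  rewrite -[m in leRHS](mulKf sn0) -mulrDr ler_pM2l//.
  rewrite -[s * m]expRK -lnM ?posrE ?expR_gt0// ler_ln ?posrE ?mulr_gt0 ?expR_gt0//; last lra.
  have xm : expR (s * x) <= expR (s * m) by rewrite ler_expR ler_pM2l.
  have m1 : 1 <= expR (s * m) by rewrite -expR0 ler_expR mulr_ge0// ltW.
  by have := expR_gt0 (s * x); nra.
(* For [x > 0] the summand [1] inside the logarithm is dropped; for [x <= 0] the left side is
   nonpositive and the right side nonnegative. *)
have low : m - s^-1 * ln s <= s^-1 * ln (1 + s^-1 * expR (s * x)).
  have lns0 : 0 <= s^-1 * ln s by rewrite mulr_ge0 ?ln_ge0// ltW.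
  have l0 : 0 <= s^-1 * ln (1 + s^-1 * expR (s * x)).
    by rewrite mulr_ge0 ?ln_ge0 ?lerDl// ltW.
  have [x0|x0] := leP x 0; first by rewrite /m max_r//; lra.
  rewrite /m max_l ?(ltW x0)// -[x in x - _](mulKf sn0) -mulrBr ler_pM2l//.
  rewrite -[s * x in leLHS]expRK -ln_div ?posrE ?expR_gt0//.
  by rewrite ler_ln ?posrE ?divr_gt0 ?expR_gt0//; [rewrite mulrC; lra|lra].
by rewrite ler_norml; apply/andP; split; lra.
Qed.

Lemma dist_le_cvg (u v : nat -> R) (l c : R) : v n @[n --> \oo] --> 0 ->
  (forall n, `|u n - l| <= c * v n) -> u n @[n --> \oo] --> l.
Proof.
move=> v0 uv; apply/subr_cvg0.
have cv0 : c * v n @[n --> \oo] --> 0 by rewrite -[X in _ --> X](mulr0 c); exact: cvgMr.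
apply: (@squeeze_cvgr _ _ _ _ (fun n => - (c * v n)) (fun n => c * v n)) => //.
  by apply: nearW => n; rewrite -ler_norml.
by rewrite -[X in _ --> X]oppr0; exact: cvgN.
Qed.

Lemma activation_cvg x :
  activation (n.+1%:R)%:E x @[n --> \oo] --> activation +oo%E x.
Proof.
apply: (@dist_le_cvg _ (fun n => (Num.sqrt n.+1%:R)^-1) _ 3).
  have -> : (fun n => (Num.sqrt n.+1%:R)^-1) = Num.sqrt \o @harmonic R.
    by apply/funext => n /=; rewrite sqrtrV.
  rewrite -(@sqrtr0 R); apply: continuous_cvg; last exact: cvg_harmonic.
  exact: sqrt_continuous.
move=> n; have := @activation_dist (Num.sqrt n.+1%:R) x.
by rewrite sqr_sqrtr//; apply; rewrite -[leLHS]sqrtr1 ler_wsqrtr// ler1n.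
Qed.

Lemma activation_deriv_cvg x :
  activation_deriv (n.+1%:R)%:E x @[n --> \oo] --> activation_deriv +oo%E x.
Proof.
have [x0|x0] := leP x 0.
  apply: (@dist_le_cvg _ (@harmonic R) _ 1); first exact: cvg_harmonic.
  move=> n; rewrite /= ltNge x0/= subr0 mul1r ger0_norm; last first.
    by rewrite divr_ge0 ?addr_ge0 ?expR_ge0.
  have s0 : 0 < n.+1%:R :> R by rewrite ltr0n.
  have : expR (n.+1%:R * x) <= 1 by rewrite expR_le1; nra.
  move: n.+1%:R s0 => s s0; have := expR_gt0 (s * x); move: (expR _) => e e0 e1.
  rewrite ler_pdivrMr ?addr_gt0// mulrDr mulVf ?gt_eqF// (le_trans e1)//.
  by rewrite lerDl mulr_ge0// ?invr_ge0 ltW.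
(* The error is [s / (s + e)] with [e = expR (s * x)]. A quadratic lower bound on [e] is needed to
   beat the numerator: [e >= 1 + (s * x) ^+ 2 / 2] yields [2 / (x ^+ 2 * s)]. *)
apply: (@dist_le_cvg _ (@harmonic R) _ (2 * x^-1 ^+ 2)); first exact: cvg_harmonic.
move=> n; rewrite /= x0/=.
have s0 : 0 < n.+1%:R :> R by rewrite ltr0n.
move: n.+1%:R s0 => s s0.
have := @expR_ge1Dxn _ (s * x) 1; rewrite mulr_ge0 ?(ltW s0) ?(ltW x0)// => /(_ isT).
rewrite (_ : 2`! = 2)%N//; move: (expR _) => e he.
have e0 : 0 < e by have := sqr_ge0 (s * x); nra.
rewrite distrC (_ : 1 - e / (s + e) = s / (s + e)); last first.
  by field; rewrite gt_eqF//; lra.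
rewrite ger0_norm; last by rewrite divr_ge0//; lra.
rewrite ler_pdivrMr; last lra.
rewrite (_ : 2 * x^-1 ^+ 2 * s^-1 * (s + e) = 2 * (s + e) / (x ^+ 2 * s)); last first.
  by field; rewrite !gt_eqF.
rewrite ler_pdivlMr ?mulr_gt0 ?exprn_gt0//; move: he.
by rewrite exprMn; nra.
Qed.

End Activation.

(** Follows from the Lipschitz estimate and the value at 0. Its uniformity in [r] is what allows one
    dominating constant for all the smoothed networks. *)
Lemma activation_bound (R : realType) (r : \bar R) x : (1 <= r)%E ->
  `|activation r x| <= 1 + `|x|.
Proof.
move=> r1; have a0 : `|activation r 0| <= 1.
  case: r r1 => [s| |]//=; last by rewrite max_l// normr0.
  rewrite lee_fin => s1; have s0 : 0 < s by lra.
  have sV0 : 0 < s^-1 by rewrite invr_gt0.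
  have sV1 : s^-1 <= 1 by rewrite invf_le1.
  rewrite mulr0 expR0 mulr1 ger0_norm; last first.
    by rewrite mulr_ge0 ?ln_ge0 ?lerDl// ltW.
  have lnV : ln (1 + s^-1) <= s^-1 by apply: le_ln1Dx; lra.
  have : 0 <= ln (1 + s^-1) by rewrite ln_ge0 ?lerDl// ltW.
  by move: (ln _) lnV => l ? ?; nra.
have := activation_lipschitz 0 x r1; rewrite subr0.
have := ler_normD (activation r 0) (activation r x - activation r 0).
by rewrite addrC subrK; lra.
Qed.

(** * Bounds and directional derivatives of the network *)

Section Network.
Context {R : realType} {H : nat}.
Implicit Types (phi e u v : 'rV[R]_(3 * H).+1) (r : \bar R) (j : 'I_H).

Definition preactivation phi j y : R :=
  phi 0 (inord j) * y + phi 0 (inord (H + j)).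

Definition preactivation_norm phi j : R :=
  `|phi 0 (inord j)| + `|phi 0 (inord (H + j))|.

Lemma preactivation_bound phi j (y : R) : 0 <= y <= 1 ->
  `|preactivation phi j y| <= preactivation_norm phi j.
Proof.
move=> /andP[y0 y1]; rewrite (le_trans (ler_normD _ _))// lerD2r normrM.
by rewrite ler_piMr// ger0_norm.
Qed.

Lemma preactivation_linear a u v j y :
  preactivation (a *: u + v) j y = a * preactivation u j y + preactivation v j y.
Proof. by rewrite /preactivation !mxE; ring. Qed.

Lemma preactivation_measurable phi j : bounded_measurable (preactivation phi j).
Proof.
apply: bounded_measurableD; last exact: bounded_measurable_cst.
by apply: bounded_measurableM; [exact: bounded_measurable_cst|exact: bounded_measurable_id].
Qed.

Lemma activation_preactivation_bound r phi j (y : R) : (1 <= r)%E -> 0 <= y <= 1 ->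
  `|activation r (preactivation phi j y)| <= 1 + preactivation_norm phi j.
Proof.
move=> r1 y01; rewrite (le_trans (activation_bound _ r1))// lerD2l.
exact: preactivation_bound.
Qed.

Lemma activation_preactivation_measurable r phi j : (1 <= r)%E ->
  bounded_measurable (fun y => activation r (preactivation phi j y)).
Proof.
move=> r1; split.
  apply: measurableT_comp; first exact: activation_measurable.
  by have [] := preactivation_measurable phi j.
by exists (1 + preactivation_norm phi j) => y; exact: activation_preactivation_bound.
Qed.

Lemma activation_deriv_preactivation_measurable r phi j : (1 <= r)%E ->
  bounded_measurable (fun y => activation_deriv r (preactivation phi j y)).
Proof.
move=> r1; split.
  apply: measurableT_comp; first exact: activation_deriv_measurable.
  by have [] := preactivation_measurable phi j.
exists 1 => y y01; have /andP[d0 d1] := activation_deriv_bound (preactivation phi j y) r1.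
by rewrite ger0_norm.
Qed.

Lemma networkE r phi y : network r phi y = phi 0 ord_max +
  \sum_(j < H) phi 0 (inord (2 * H + j)) * activation r (preactivation phi j y).
Proof. by []. Qed.

Definition network_bound phi : R := `|phi 0 ord_max| +
  \sum_(j < H) `|phi 0 (inord (2 * H + j))| * (1 + preactivation_norm phi j).

Lemma le_network_bound r phi (y : R) : (1 <= r)%E -> 0 <= y <= 1 ->
  `|network r phi y| <= network_bound phi.
Proof.
move=> r1 y01; rewrite networkE (le_trans (ler_normD _ _))// lerD2l.
rewrite (le_trans (ler_norm_sum _ _ _))// ler_sum// => j _.
by rewrite normrM ler_wpM2l// activation_preactivation_bound.
Qed.

Lemma network_measurable r phi : (1 <= r)%E -> bounded_measurable (network r phi).
Proof.
move=> r1; apply: bounded_measurableD; first exact: bounded_measurable_cst.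
apply: bounded_measurable_sum => j.
apply: bounded_measurableM; first exact: bounded_measurable_cst.
exact: activation_preactivation_measurable.
Qed.

(** The chain rule in direction [e]. At [r = +oo] it uses the left derivative of the ReLU, so it is
    linear in [e] at every [phi], even where the network is not differentiable. *)
Definition network_deriv r phi e y : R := e 0 ord_max +
  \sum_(j < H) (e 0 (inord (2 * H + j)) * activation r (preactivation phi j y) +
    phi 0 (inord (2 * H + j)) *
      (activation_deriv r (preactivation phi j y) * preactivation e j y)).

Lemma network_deriv_linear r phi a u v y :
  network_deriv r phi (a *: u + v) y =
  a * network_deriv r phi u y + network_deriv r phi v y.
Proof.
rewrite /network_deriv mulrDr addrACA !mxE; congr (_ + _).
rewrite mulr_sumr -big_split/=; apply: eq_bigr => j _.
by rewrite !mxE preactivation_linear; ring.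
Qed.

Lemma network_deriv_delta r phi e y :
  network_deriv r phi e y = \sum_i e 0 i * network_deriv r phi (delta_mx 0 i) y.
Proof.
have nd0 : network_deriv r phi 0 y = 0.
  have := network_deriv_linear r phi 1 0 0 y; rewrite scaler0 addr0 mul1r; lra.
rewrite {1}[e]row_sum_delta.
rewrite (big_morph (fun e => network_deriv r phi e y) (id1 := 0) (op1 := +%R))//.
  apply: eq_bigr => i _.
  by have := network_deriv_linear r phi (e 0 i) (delta_mx 0 i) 0 y; rewrite nd0 !addr0.
by move=> u v; have := network_deriv_linear r phi 1 u v y; rewrite scale1r mul1r.
Qed.

Lemma network_deriv_measurable r phi e : (1 <= r)%E ->
  bounded_measurable (network_deriv r phi e).
Proof.
move=> r1; apply: bounded_measurableD; first exact: bounded_measurable_cst.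
apply: bounded_measurable_sum => j; apply: bounded_measurableD.
  apply: bounded_measurableM; first exact: bounded_measurable_cst.
  exact: activation_preactivation_measurable.
apply: bounded_measurableM; first exact: bounded_measurable_cst.
apply: bounded_measurableM; last exact: preactivation_measurable.
exact: activation_deriv_preactivation_measurable.
Qed.

Definition network_deriv_bound phi e : R := `|e 0 ord_max| +
  \sum_(j < H) (`|e 0 (inord (2 * H + j))| * (1 + preactivation_norm phi j) +
    `|phi 0 (inord (2 * H + j))| * preactivation_norm e j).

Lemma le_network_deriv_bound r phi e (y : R) : (1 <= r)%E -> 0 <= y <= 1 ->
  `|network_deriv r phi e y| <= network_deriv_bound phi e.
Proof.
move=> r1 y01; rewrite (le_trans (ler_normD _ _))// lerD2l.
rewrite (le_trans (ler_norm_sum _ _ _))// ler_sum// => j _.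
rewrite (le_trans (ler_normD _ _))// lerD// !normrM ler_wpM2l//.
  exact: activation_preactivation_bound.
have /andP[d0 d1] := activation_deriv_bound (preactivation phi j y) r1.
by rewrite (le_trans _ (preactivation_bound e j y01))// ler_piMl// ger0_norm.
Qed.

Definition network_quotient r phi e h y : R :=
  h^-1 * (network r (phi + h *: e) y - network r phi y).

Lemma network_quotientE r phi e h y : h != 0 ->
  network_quotient r phi e h y = e 0 ord_max +
  \sum_(j < H) (e 0 (inord (2 * H + j)) *
      activation r (preactivation phi j y + h * preactivation e j y) +
    phi 0 (inord (2 * H + j)) *
      (h^-1 * (activation r (preactivation phi j y + h * preactivation e j y) -
        activation r (preactivation phi j y)))).
Proof.
move=> h0; rewrite /network_quotient !networkE !mxE opprD addrACA mulrDr.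
congr (_ + _); first by field.
rewrite -sumrB mulr_sumr; apply: eq_bigr => j _.
rewrite !mxE [phi + _]addrC preactivation_linear [_ + preactivation phi j y]addrC.
by move: (activation _ _) (activation _ _) => a b; field.
Qed.

(** The Lipschitz estimate cancels [h^-1]. The additional sum pays for evaluating the activation at
    the shifted pre-activation; only the bound [C] on the increment enters. *)
Lemma network_quotient_bound r phi e (h C y : R) : (1 <= r)%E -> h != 0 -> `|h| <= C ->
  0 <= y <= 1 ->
  `|network_quotient r phi e h y| <= network_deriv_bound phi e +
    \sum_(j < H) `|e 0 (inord (2 * H + j))| * (C * preactivation_norm e j).
Proof.
move=> r1 h0 hC y01; rewrite network_quotientE// -addrA -big_split/=.
rewrite (le_trans (ler_normD _ _))// lerD2l.
rewrite (le_trans (ler_norm_sum _ _ _))// ler_sum// => j _.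
have C0 : 0 <= C by rewrite (le_trans _ hC).
have hp : `|h * preactivation e j y| <= C * preactivation_norm e j.
  by rewrite normrM ler_pM// preactivation_bound.
rewrite (le_trans (ler_normD _ _))// [leRHS]addrAC lerD// !normrM.
  rewrite -mulrDr ler_wpM2l// (le_trans (activation_bound _ r1))// -[leRHS]addrA lerD2l.
  by rewrite (le_trans (ler_normD _ _))// lerD// preactivation_bound.
rewrite ler_wpM2l// normfV ler_pdivrMl ?normr_gt0//.
rewrite (le_trans (activation_lipschitz _ _ r1))//.
rewrite (addrC (preactivation phi j y)) addrK normrM.
by rewrite ler_wpM2l// preactivation_bound.
Qed.

(* At [r = +oo] the activation is only left differentiable, hence the sign
   conditions. *)
Definition admissible_increments r e (h : nat -> R) :=
  [/\ h n @[n --> \oo] --> 0, forall n, h n != 0 &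
    r = +oo%E -> (forall i, 0 <= e 0 i) /\ forall n, h n < 0].

Lemma network_quotient_cvg r phi e (h : nat -> R) (y : R) : (1 <= r)%E ->
  admissible_increments r e h -> 0 <= y <= 1 ->
  network_quotient r phi e (h n) y @[n --> \oo] --> network_deriv r phi e y.
Proof.
move=> r1 [h0 hn0 hr] /andP[y0 y1].
under eq_fun do rewrite network_quotientE//.
apply: cvgD; first exact: cvg_cst.
apply: cvg_big => [|j _]; first exact: add_continuous.
have quot := activation_difference_quotient (z := preactivation phi j y)
  (a := preactivation e j y) r1 h0 hn0.
apply: cvgD.
  apply: cvgM; first exact: cvg_cst.
  apply/subr_cvg0; apply/norm_cvg0P.
  have hp : `|h n| * `|preactivation e j y| @[n --> \oo] --> 0.
    rewrite -[X in _ --> X](mul0r `|preactivation e j y|); apply: cvgMl.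
    by rewrite -[X in _ --> X](@normr0 _ R); exact: cvg_norm.
  apply: (@squeeze_cvgr _ _ _ _ (fun=> 0) _ _ _ _ _ hp); last exact: cvg_cst.
  apply: nearW => n; rewrite normr_ge0/= -normrM.
  by rewrite (le_trans (activation_lipschitz _ _ r1))// (addrC (preactivation phi j y)) addrK.
apply: cvgM; first exact: cvg_cst.
apply: quot => /hr[e0 hneg]; split => //.
(* Here [0 <= y] matters: with nonnegative coordinates of [e] it makes [preactivation e j y]
   nonnegative. *)
by rewrite addr_ge0 ?mulr_ge0.
Qed.

End Network.

(** * Gradients of the risks and identification of their limit *)

Section RiskDerivative.
Context {R : realType} {H : nat}.
Variable alpha : R.
Implicit Types (phi e : 'rV[R]_(3 * H).+1) (r : \bar R).

Lemma risk_integrand_measurable r phi : (1 <= r)%E ->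
  bounded_measurable (fun y => network r phi y - alpha).
Proof.
move=> r1; apply: bounded_measurableD; first exact: network_measurable.
exact: bounded_measurable_cst.
Qed.

Lemma riskE r phi :
  risk alpha r phi = integral01 (fun y => (network r phi y - alpha) ^+ 2).
Proof. by []. Qed.

Definition risk_deriv r phi e : R :=
  integral01 (fun y => 2 * (network r phi y - alpha) * network_deriv r phi e y).

Lemma risk_deriv_measurable r phi e : (1 <= r)%E ->
  bounded_measurable (fun y => 2 * (network r phi y - alpha) * network_deriv r phi e y).
Proof.
move=> r1; apply: bounded_measurableM; last exact: network_deriv_measurable.
apply: bounded_measurableM; first exact: bounded_measurable_cst.
exact: risk_integrand_measurable.
Qed.

(** Difference of squares: if [a] and [b] are the shifted and unshifted network values and [q] is
    the quotient, then [a = b + h * q], so the other factor is [2 * (b - alpha) + h * q]. *)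
Lemma risk_quotientE r phi e (h : R) : (1 <= r)%E -> h != 0 ->
  h^-1 * (risk alpha r (phi + h *: e) - risk alpha r phi) =
  integral01 (fun y => network_quotient r phi e h y *
    (2 * (network r phi y - alpha) + h * network_quotient r phi e h y)).
Proof.
move=> r1 h0.
have sqm (psi : 'rV[R]_(3 * H).+1) :
    bounded_measurable (fun y => (network r psi y - alpha) ^+ 2).
  by apply: bounded_measurableM; exact: risk_integrand_measurable.
have -> : risk alpha r (phi + h *: e) - risk alpha r phi =
    integral01 (fun y => (network r (phi + h *: e) y - alpha) ^+ 2 +
      (-1) * (network r phi y - alpha) ^+ 2).
  rewrite integral01D//; last first.
    by apply: bounded_measurableM => //; exact: bounded_measurable_cst.
  by rewrite integral01Z// mulN1r.
rewrite -integral01Z; last first.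
  apply: bounded_measurableD => //.
  by apply: bounded_measurableM => //; exact: bounded_measurable_cst.
apply: eq_integral01 => y _; rewrite /network_quotient.
by move: (network _ _ _) (network _ _ _) => a b; field.
Qed.

Lemma risk_quotient_cvg r phi e (h : nat -> R) : (1 <= r)%E ->
  admissible_increments r e h ->
  (h n)^-1 * (risk alpha r (phi + h n *: e) - risk alpha r phi) @[n --> \oo] -->
  risk_deriv r phi e.
Proof.
move=> r1 hadm; have [h0 hn0 _] := hadm.
have [C hC] : exists C : R, forall n, `|h n| <= C.
  have [M [_ hM]] := cvg_seq_bounded (cvgP _ h0).
  by exists (M + 1) => n; apply: (hM (M + 1)); rewrite ?ltrDl.
under eq_fun do rewrite risk_quotientE//.
pose K := network_deriv_bound phi e +
  \sum_(j < H) `|e 0 (inord (2 * H + j))| * (C * preactivation_norm e j).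
have qK n (y : R) : 0 <= y <= 1 -> `|network_quotient r phi e (h n) y| <= K.
  by move=> y01; exact: network_quotient_bound.
have qm n : bounded_measurable (network_quotient r phi e (h n)).
  apply: bounded_measurableM; first exact: bounded_measurable_cst.
  apply: bounded_measurableD; first exact: network_measurable.
  split; first by apply: measurableT_comp => //; have [] := network_measurable phi r1.
  by exists (network_bound phi) => y y01; rewrite normrN le_network_bound.
apply: (@bounded_convergence _ _ _ (K * (2 * (network_bound phi + `|alpha|) + C * K))).
- move=> n; suff [] : bounded_measurable (fun y => network_quotient r phi e (h n) y *
    (2 * (network r phi y - alpha) + h n * network_quotient r phi e (h n) y)) by [].
  apply: bounded_measurableM => //; apply: bounded_measurableD.
    apply: bounded_measurableM; first exact: bounded_measurable_cst.
    exact: risk_integrand_measurable.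
  by apply: bounded_measurableM => //; exact: bounded_measurable_cst.
- move=> n y y01; rewrite normrM ler_pM ?qK// (le_trans (ler_normD _ _))//.
  rewrite lerD//; last by rewrite normrM ler_pM ?qK.
  rewrite normrM normr_nat ler_wpM2l//.
  by rewrite (le_trans (ler_normB _ _))// lerD2r le_network_bound.
- move=> y y01; have qy := network_quotient_cvg (phi := phi) r1 hadm y01.
  rewrite [X in _ --> X]mulrC; apply: cvgM => //.
  rewrite -[X in _ --> X]addr0; apply: cvgD; first exact: cvg_cst.
  by rewrite -[X in _ --> X](mul0r (network_deriv r phi e y)); exact: cvgM.
Qed.

Lemma gradient_risk s phi : 1 <= s ->
  gradient (risk alpha s%:E) phi = \row_i risk_deriv s%:E phi (delta_mx 0 i).
Proof.
move=> s1; apply/rowP => i; rewrite !mxE /derive; apply: cvg_lim => //.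
apply/cvgr_dnbhsP => h [hn0 h0].
have s1E : (1 <= s%:E)%E by rewrite lee_fin.
have adm : admissible_increments s%:E (delta_mx 0 i : 'rV[R]_(3 * H).+1) h by split.
apply: cvg_trans (risk_quotient_cvg (phi := phi) s1E adm).
apply: near_eq_cvg; near=> n => /=; by rewrite [_ + phi]addrC.
Unshelve. all: by end_near. Qed.

(** Differentiability makes each partial derivative the limit along any null sequence of nonzero
    increments. Basis vectors have nonnegative coordinates, so negative increments are admissible
    and the left quotients identify that limit. *)
Lemma gradient_risk_infty phi : differentiable (risk alpha +oo%E) phi ->
  gradient (risk alpha +oo%E) phi = \row_i risk_deriv +oo%E phi (delta_mx 0 i).
Proof.
move=> dphi; apply/rowP => i; rewrite !mxE.
have dquot : k^-1 *: (risk alpha +oo%E (k *: delta_mx 0 i + phi) - risk alpha +oo%E phi)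
    @[k --> 0^'] --> 'D_(delta_mx 0 i) (risk alpha +oo%E) phi.
  exact: diff_derivable.
pose h n : R := - harmonic n.
have h0 : h n @[n --> \oo] --> 0.
  by rewrite -[X in _ --> X]oppr0; apply: cvgN; exact: cvg_harmonic.
have hneg n : h n < 0 by rewrite /h /= oppr_lt0 invr_gt0 ltr0n.
have hn0 n : h n != 0 by rewrite lt_eqF.
have quot := (cvgr_dnbhsP _ _ _).1 dquot h (conj hn0 h0).
have adm : admissible_increments +oo%E (delta_mx 0 i) h.
  by split => // _; split => // k; rewrite mxE eqxx/= ler0n.
have := @risk_quotient_cvg +oo%E phi _ _ (leey _) adm.
apply: cvg_unique => //; apply: cvg_trans quot; apply: near_eq_cvg.
by near=> n => /=; rewrite [_ + phi]addrC.
Unshelve. all: by end_near. Qed.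

Lemma risk_deriv_cvg phi e :
  risk_deriv (n.+1%:R)%:E phi e @[n --> \oo] --> risk_deriv +oo%E phi e.
Proof.
have s1 n : (1 <= (n.+1%:R)%:E :> \bar R)%E by rewrite lee_fin ler1n.
apply: (@bounded_convergence _ _ _ (2 * (network_bound phi + `|alpha|) *
  network_deriv_bound phi e)).
- by move=> n; have [] := risk_deriv_measurable phi e (s1 n).
- move=> n y y01; rewrite normrM ler_pM ?le_network_deriv_bound//.
  rewrite normrM normr_nat ler_wpM2l// (le_trans (ler_normB _ _))//.
  by rewrite lerD2r le_network_bound.
move=> y y01; apply: cvgM.
  apply: cvgM; first exact: cvg_cst.
  apply: cvgB; last exact: cvg_cst.
  apply: cvgD; first exact: cvg_cst.
  apply: cvg_big => [|j _]; first exact: add_continuous.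
  by apply: cvgM; [exact: cvg_cst|exact: activation_cvg].
apply: cvgD; first exact: cvg_cst.
apply: cvg_big => [|j _]; first exact: add_continuous.
apply: cvgD; apply: cvgM; try exact: cvg_cst; first exact: activation_cvg.
by apply: cvgM; [exact: activation_deriv_cvg|exact: cvg_cst].
Qed.

Lemma gradient_risk_cvg phi :
  gradient (risk alpha (n.+1%:R)%:E) phi @[n --> \oo] -->
  \row_i risk_deriv +oo%E phi (delta_mx 0 i).
Proof.
(* Expanding in the standard basis reduces convergence of row vectors to that of the coordinates. *)
have -> : (fun n => gradient (risk alpha (n.+1%:R)%:E) phi) = (fun n =>
    \sum_i risk_deriv (n.+1%:R)%:E phi (delta_mx 0 i) *: (delta_mx 0 i : 'rV[R]_(3 * H).+1)).
  apply/funext => n; rewrite gradient_risk ?ler1n// [LHS]row_sum_delta.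
  by apply: eq_bigr => i _; rewrite mxE.
rewrite [X in _ --> X]row_sum_delta.
apply: cvg_big => [|i _]; first exact: add_continuous.
by rewrite mxE; apply: cvgZ; [exact: risk_deriv_cvg|exact: cvg_cst].
Qed.

Lemma sum_risk_deriv r phi e : (1 <= r)%E ->
  \sum_i e 0 i * risk_deriv r phi (delta_mx 0 i) = risk_deriv r phi e.
Proof.
move=> r1; rewrite -[RHS](eq_integral01 (f := fun y => \sum_i e 0 i *
    (2 * (network r phi y - alpha) * network_deriv r phi (delta_mx 0 i) y))).
  rewrite integral01_sum.
    by apply: eq_bigr => i _; rewrite integral01Z//; exact: risk_deriv_measurable.
  move=> i; apply: bounded_measurableM; first exact: bounded_measurable_cst.
  exact: risk_deriv_measurable.
move=> y _; rewrite [in RHS]network_deriv_delta mulr_sumr.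
by apply: eq_bigr => i _; ring.
Qed.

End RiskDerivative.

(** * Lyapunov function, gradient bound and descent step *)

Section Lyapunov.
Context {R : realType} {H : nat}.
Variable alpha : R.
Implicit Types phi e : 'rV[R]_(3 * H).+1.

Lemma sum_coordinates (F : 'I_(3 * H).+1 -> R) : \sum_i F i = F ord_max +
  \sum_(j < H) (F (inord j) + F (inord (H + j)) + F (inord (2 * H + j))).
Proof.
rewrite big_ord_recr/= addrC; congr (_ + _).
have E3 : (3 * H = H + H + H)%N by lia.
(* Extending [F] to natural numbers frees the summation range from the ordinal type, so [3 * H] can
   be rewritten as three blocks of length [H]. *)
pose F' k := F (inord k).
rewrite (eq_bigr (fun i : 'I_(3 * H) => F' i)); last first.
  by move=> i _; congr F; apply: val_inj; rewrite /= inordK// ltnS ltnW.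
rewrite -(big_mkord xpredT F').
have -> : \sum_(0 <= i < 3 * H) F' i = \sum_(0 <= i < H + H + H) F' i by rewrite E3.
rewrite !big_mkord !big_split_ord !big_split/=.
by congr (_ + _); apply: eq_bigr => j _; rewrite mul2n -addnn.
Qed.

Definition sqnorm phi : R := \sum_i phi 0 i ^+ 2.

Lemma sqnorm_ge0 phi : 0 <= sqnorm phi.
Proof. by apply: sumr_ge0 => i _; exact: sqr_ge0. Qed.

Lemma euclidean_normE phi : euclidean_norm phi = Num.sqrt (sqnorm phi).
Proof. by congr Num.sqrt; apply: eq_bigr => i _; rewrite real_normK ?num_real. Qed.

Lemma sqr_bias_le phi : phi 0 ord_max ^+ 2 <= sqnorm phi.
Proof.
rewrite /sqnorm (bigD1 ord_max)//= lerDl.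
by apply: sumr_ge0 => i _; exact: sqr_ge0.
Qed.

Lemma network_deriv_self phi y :
  network_deriv +oo%E phi phi y = 2 * network +oo%E phi y - phi 0 ord_max.
Proof.
rewrite networkE /network_deriv mulrDr mulr_sumr addrAC; congr (_ + _); first by ring.
apply: eq_bigr => j _; have -> : activation_deriv +oo%E (preactivation phi j y) *
    preactivation phi j y = activation +oo%E (preactivation phi j y).
  by rewrite /=; case: ltP; rewrite ?mul1r ?mul0r.
by ring.
Qed.

Lemma network_deriv_bias phi (y : R) :
  network_deriv +oo%E phi (delta_mx 0 ord_max) y = 1.
Proof.
have neq (k : nat) : (k < 3 * H)%N -> (inord k == ord_max :> 'I_(3 * H).+1) = false.
  by move=> k3; rewrite -val_eqE/= inordK ?ltn_eqF// ltnS ltnW.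
rewrite /network_deriv mxE !eqxx big1 ?addr0// => j _; have jH := ltn_ord j.
rewrite /preactivation !mxE !neq ?andbF ?mul0r ?add0r ?mulr0//; lia.
Qed.

(** With [c] the output bias and [N] the network, differentiating [N] along [phi] leaves
    [2 * N - c]. The derivative in the bias direction is 1, so the added square contributes
    [c - 2 * alpha], and the sum is exactly [2 * (N - alpha)]. *)
Definition lyapunov phi : R := sqnorm phi + (phi 0 ord_max - 2 * alpha) ^+ 2.

Definition risk_gradient phi : 'rV[R]_(3 * H).+1 :=
  \row_i risk_deriv alpha +oo%E phi (delta_mx 0 i).

Local Notation L := (risk alpha +oo%E).
Local Notation g := risk_gradient.

Let oo1 : (1 <= +oo :> \bar R)%E. Proof. exact: leey. Qed.

Lemma risk_ge0 phi : 0 <= L phi.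
Proof. by apply: integral01_ge0 => y _; exact: sqr_ge0. Qed.

Lemma risk_gradient_dot phi e :
  \sum_i e 0 i * g phi 0 i = risk_deriv alpha +oo%E phi e.
Proof.
by rewrite -sum_risk_deriv//; apply: eq_bigr => i _; rewrite mxE.
Qed.

(* Half the derivative of [lyapunov] along the gradient. *)
Lemma lyapunov_gradient phi :
  \sum_i phi 0 i * g phi 0 i + (phi 0 ord_max - 2 * alpha) * g phi 0 ord_max =
  4 * L phi.
Proof.
rewrite risk_gradient_dot mxE /risk_deriv -integral01Z; last exact: risk_deriv_measurable.
rewrite -integral01D; [|exact: risk_deriv_measurable|]; last first.
  apply: bounded_measurableM; first exact: bounded_measurable_cst.
  exact: risk_deriv_measurable.
rewrite riskE -integral01Z; last first.
  by apply: bounded_measurableM; exact: risk_integrand_measurable.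
apply: eq_integral01 => y _; rewrite network_deriv_self network_deriv_bias.
by ring.
Qed.

(** The squared norm of the gradient is the derivative in the direction of the gradient itself. A
    pointwise Young inequality bounds it by [2 * K * L phi] plus half of the squared norm, which is
    then absorbed on the left. *)
Lemma risk_gradient_norm phi : sqnorm (g phi) <= 4 * L phi * (1 + 2 * sqnorm phi).
Proof.
have sqE : sqnorm (g phi) = risk_deriv alpha +oo%E phi (g phi).
  by rewrite -risk_gradient_dot; apply: eq_bigr => i _; rewrite expr2.
pose K := 1 + 2 * sqnorm phi.
have fm : bounded_measurable (fun y => (network +oo%E phi y - alpha) ^+ 2).
  by apply: bounded_measurableM; exact: risk_integrand_measurable.
have fKm : bounded_measurable (fun y => 2 * K * (network +oo%E phi y - alpha) ^+ 2).
  by apply: bounded_measurableM => //; exact: bounded_measurable_cst.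
suff : risk_deriv alpha +oo%E phi (g phi) <= 2 * K * L phi + sqnorm (g phi) / 2.
  by rewrite -sqE /K; lra.
rewrite riskE -integral01Z// -[X in _ + X]integral01_cst -integral01D//; last first.
  exact: bounded_measurable_cst.
apply: le_integral01; [exact: risk_deriv_measurable| |].
  by apply: bounded_measurableD => //; exact: bounded_measurable_cst.
move=> y /andP[y0 y1]; set f := _ - alpha; set e := g phi.
have -> : 2 * f * network_deriv +oo%E phi e y = 2 * f * e 0 ord_max +
   \sum_(j < H) 2 * f * (e 0 (inord (2 * H + j)) * activation +oo%E (preactivation phi j y) +
    phi 0 (inord (2 * H + j)) *
      (activation_deriv +oo%E (preactivation phi j y) * preactivation e j y)).
  by rewrite -mulr_sumr -mulrDr.
(* The output bias of [phi] is discarded from [K]; the leading [1] accounts for the derivative in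
   the bias direction. *)
have KE : 1 + \sum_(j < H) (2 * phi 0 (inord j) ^+ 2 + 2 * phi 0 (inord (H + j)) ^+ 2 +
    2 * phi 0 (inord (2 * H + j)) ^+ 2) <= K.
  rewrite lerD2l /sqnorm sum_coordinates mulrDr mulr_sumr.
  rewrite -[leLHS]add0r; apply: lerD; first by have := sqr_ge0 (phi 0 ord_max); lra.
  by apply: ler_sum => j _; lra.
(* AM-GM on every summand: [2 f d e <= 2 f^2 d^2 + e^2 / 2] *)
apply: (@le_trans _ _ (2 * f ^+ 2 + e 0 ord_max ^+ 2 / 2 +
  \sum_(j < H) (2 * f ^+ 2 * (2 * phi 0 (inord j) ^+ 2 + 2 * phi 0 (inord (H + j)) ^+ 2 +
    2 * phi 0 (inord (2 * H + j)) ^+ 2) +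
   (e 0 (inord j) ^+ 2 + e 0 (inord (H + j)) ^+ 2 + e 0 (inord (2 * H + j)) ^+ 2) / 2))).
  apply: lerD; first by have := sqr_ge0 (2 * f - e 0 ord_max); lra.
  apply: ler_sum => j _; rewrite /preactivation.
  move: (phi 0 (inord j)) (phi 0 (inord (H + j))) (phi 0 (inord (2 * H + j))) => w b v.
  move: (e 0 (inord j)) (e 0 (inord (H + j))) (e 0 (inord (2 * H + j))) => ew eb ev.
  have f2 := sqr_ge0 f; have y2 : y ^+ 2 <= 1 by rewrite expr_le1.
  have sum0 : 0 <= 2 * f ^+ 2 * (2 * w ^+ 2 + 2 * b ^+ 2 + 2 * v ^+ 2) +
      (ew ^+ 2 + eb ^+ 2 + ev ^+ 2) / 2.
    have := (sqr_ge0 w, sqr_ge0 b, sqr_ge0 v, sqr_ge0 ew, sqr_ge0 eb, sqr_ge0 ev).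
    by move=> [[[[[? ?] ?] ?] ?] ?]; apply: addr_ge0; [apply: mulr_ge0|]; lra.
  rewrite /activation_deriv /activation; case: (ltP 0 (w * y + b)) => z0; last first.
    by rewrite !(mul0r, mulr0, addr0).
  (* Active neuron: [vz], [vb], [vw] are the Young inequalities for the output weight, hidden bias
     and input weight. The term in [v ^+ 2] arises twice, from [vb] and, as [y ^+ 2 <= 1], from
     [vw]. *)
  rewrite mul1r; set z := w * y + b.
  have z2 : z ^+ 2 <= 2 * w ^+ 2 + 2 * b ^+ 2.
    have := ler_wpM2l (sqr_ge0 w) y2; have := sqr_ge0 (w * y - b).
    by rewrite /z; lra.
  have vz := sqr_ge0 (2 * f * z - ev); have vb := sqr_ge0 (2 * f * v - eb).
  have vw := sqr_ge0 (2 * f * v * y - ew).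
  have fz := ler_wpM2l f2 z2.
  have fy : (f * v) ^+ 2 * y ^+ 2 <= (f * v) ^+ 2 * 1 by rewrite ler_wpM2l ?sqr_ge0.
  by lra.
rewrite big_split/= -mulr_sumr -mulr_suml /sqnorm (sum_coordinates (fun i => e 0 i ^+ 2)).
have f2 := sqr_ge0 f.
move: KE; move: (\sum_(j < H) _) (\sum_(j < H) _) => A B; nra.
Qed.

(** Since [lyapunov] is quadratic, its expansion is exact: the first-order term is
    [- 8 * gamma * L phi]. The second-order term is at most [2 * gamma ^+ 2 * sqnorm (g phi)], and
    the step-size condition makes this at most [4 * gamma * L phi]. *)
Lemma lyapunov_step gamma phi : 0 < gamma -> gamma * (1 + 2 * sqnorm phi) <= 1 / 2 ->
  lyapunov (phi - gamma *: g phi) <= lyapunov phi - 4 * gamma * L phi.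
Proof.
move=> gamma0 small.
have -> : lyapunov (phi - gamma *: g phi) = lyapunov phi - 2 * gamma *
   (\sum_i phi 0 i * g phi 0 i + (phi 0 ord_max - 2 * alpha) * g phi 0 ord_max) +
   gamma ^+ 2 * (sqnorm (g phi) + g phi 0 ord_max ^+ 2).
  rewrite /lyapunov !mxE.
  have -> : sqnorm (phi - gamma *: g phi) = sqnorm phi -
     2 * gamma * (\sum_i phi 0 i * g phi 0 i) + gamma ^+ 2 * sqnorm (g phi).
    rewrite /sqnorm !mulr_sumr -sumrB -big_split/=; apply: eq_bigr => i _.
    by rewrite !mxE; ring.
  by ring.
rewrite lyapunov_gradient.
have := risk_gradient_norm phi; have := sqr_bias_le (g phi); have := risk_ge0 phi.
move: (L phi) (sqnorm (g phi)) (g phi 0 ord_max ^+ 2) (1 + 2 * sqnorm phi) small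
  => l G G0 K small l0 G0G GK.
have h1 : gamma ^+ 2 * (G + G0) <= gamma ^+ 2 * (8 * l * K).
  by rewrite ler_wpM2l ?sqr_ge0//; lra.
have h2 : (gamma * l) * (gamma * K) <= (gamma * l) * (1 / 2).
  by rewrite ler_wpM2l ?mulr_ge0// ltW.
by move: h1 h2; rewrite expr2; lra.
Qed.

Lemma lyapunov_ge_sqnorm phi : sqnorm phi <= lyapunov phi.
Proof. by rewrite lerDl sqr_ge0. Qed.

(** Stated with [lyapunov] rather than [sqnorm] so that the smallness at the initial point passes to
    every point with a smaller Lyapunov value. *)
Lemma step_size_small gamma phi : 0 < gamma ->
  gamma <= (4 * euclidean_norm phi + 6 * `|alpha| + 2) ^- 2 ->
  gamma * (1 + 2 * lyapunov phi) <= 1 / 2.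
Proof.
move=> gamma0; rewrite euclidean_normE; set t := Num.sqrt _.
have t0 : 0 <= t by exact: sqrtr_ge0.
have tE : t ^+ 2 = sqnorm phi by rewrite sqr_sqrtr// sqnorm_ge0.
have a0 : 0 <= `|alpha| by [].
have aE : `|alpha| ^+ 2 = alpha ^+ 2 by rewrite real_normK ?num_real.
set X := _ + 2 => hX; have X0 : 0 < X ^+ 2 by rewrite exprn_gt0// /X; lra.
have gX : gamma * X ^+ 2 <= 1 by rewrite -ler_pdivlMr// mul1r.
have VX : 2 * (1 + 2 * lyapunov phi) <= X ^+ 2.
  rewrite /lyapunov -tE /X; have := sqr_bias_le phi; rewrite -tE.
  (* With [c] the output bias, this gives [(c - 2 * alpha) ^+ 2 <= 2 * c ^+ 2 + 8 * alpha ^+ 2],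
     whence [lyapunov phi <= 3 * t ^+ 2 + 8 * alpha ^+ 2]. *)
  have := sqr_ge0 (phi 0 ord_max + 2 * alpha).
  have := mulr_ge0 t0 a0.
  by move: aE; move: `|alpha| a0 (phi 0 _) => a a0 c; nra.
by have := ler_wpM2l (ltW gamma0) VX; lra.
Qed.

End Lyapunov.

(** * Summable decrease and convergence of gradient descent *)

Lemma telescoping_decay (R : realType) (V l : nat -> R) :
  (forall n, 0 <= V n) -> (forall n, 0 <= l n) ->
  (forall n, V n.+1 <= V n - l n) -> l n @[n --> \oo] --> 0.
Proof.
move=> V0 l0 step; apply: cvg_series_cvg_0; apply: nondecreasing_is_cvgn.
  by apply: nondecreasing_series => n _ _; exact: l0.
exists (V 0%N) => _ [n _ <-]; rewrite /series/=.
suff : \sum_(0 <= k < n) l k <= V 0%N - V n by have := V0 n; lra.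
elim: n => [|n IHn]; first by rewrite big_geq// subrr.
by rewrite big_nat_recr//=; have := step n; lra.
Qed.

Theorem theorem1p1 (R : realType) (H : nat) (alpha gamma : R)
    (G : 'rV[R]_(3 * H).+1 -> 'rV[R]_(3 * H).+1)
    (Theta : nat -> 'rV[R]_(3 * H).+1)
    (H_gt0 : (0 < H)%N)
    (gamma_gt0 : 0 < gamma)
    (G_lim : forall phi : 'rV[R]_(3 * H).+1,
      cvgn (fun r : nat => gradient (risk alpha (r.+1%:R)%:E) phi) ->
      G phi = limn (fun r : nat => gradient (risk alpha (r.+1%:R)%:E) phi))
    (Theta_rec : forall n : nat,
      Theta n.+1 = Theta n - gamma *: G (Theta n))
    (gamma_le :
      gamma <= (4 * euclidean_norm (Theta 0%N) + 6 * `|alpha| + 2) ^- 2) :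
  [/\ forall phi : 'rV[R]_(3 * H).+1,
        differentiable (risk alpha +oo%E) phi ->
        gradient (risk alpha +oo%E) phi = G phi,
      (ereal_sup (range (fun n => (euclidean_norm (Theta n))%:E)) < +oo)%E &
      limn_esup (fun n => (risk alpha +oo%E (Theta n))%:E) = 0%E].
Proof.
(* The smooth gradients converge at every parameter, so [G] is known everywhere, not only where the
   ReLU risk is differentiable. *)
have GE phi : G phi = risk_gradient alpha phi.
  have lim_phi := gradient_risk_cvg (alpha := alpha) (phi := phi).
  by rewrite G_lim; [exact: cvg_lim|exact: cvgP lim_phi].
have V0_small := step_size_small gamma_gt0 gamma_le.
(* Both claims go through one induction: the decrease at step [n] needs the step-size condition
   there, which comes from the bound by the initial Lyapunov value. *)
have Vle n : lyapunov alpha (Theta n) <= lyapunov alpha (Theta 0%N) /\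
    lyapunov alpha (Theta n.+1) <=
      lyapunov alpha (Theta n) - 4 * gamma * risk alpha +oo%E (Theta n).
  have step m : lyapunov alpha (Theta m) <= lyapunov alpha (Theta 0%N) ->
      lyapunov alpha (Theta m.+1) <=
        lyapunov alpha (Theta m) - 4 * gamma * risk alpha +oo%E (Theta m).
    move=> Vm; rewrite Theta_rec GE; apply: lyapunov_step => //.
    rewrite (le_trans _ V0_small)// ler_pM2l// lerD2l ler_pM2l//.
    exact: le_trans (lyapunov_ge_sqnorm _ _) Vm.
  elim: n => [|n [IHn stepn]]; first by split => //; exact: step.
  suff Vn : lyapunov alpha (Theta n.+1) <= lyapunov alpha (Theta 0%N).
    by split => //; exact: step.
  have := mulr_ge0 (ltW gamma_gt0) (risk_ge0 alpha (Theta n)); lra.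
split.
- by move=> phi dphi; rewrite GE gradient_risk_infty.
- apply: (@le_lt_trans _ _ (Num.sqrt (lyapunov alpha (Theta 0%N)))%:E); last exact: ltry.
  apply: ge_ereal_sup => _ [n _ <-]; rewrite lee_fin euclidean_normE ler_wsqrtr//.
  exact: le_trans (lyapunov_ge_sqnorm _ _) (Vle n).1.
have c0 : 0 < 4 * gamma by rewrite mulr_gt0.
have decay : 4 * gamma * risk alpha +oo%E (Theta n) @[n --> \oo] --> 0.
  apply: (@telescoping_decay _ (fun n => lyapunov alpha (Theta n))).
  - by move=> n; rewrite (le_trans _ (lyapunov_ge_sqnorm _ _))// sqnorm_ge0.
  - by move=> n; rewrite mulr_ge0 ?(ltW c0)// risk_ge0.
  - by move=> n; exact: (Vle n).2.
have risk0 : risk alpha +oo%E (Theta n) @[n --> \oo] --> 0.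
  have : (4 * gamma)^-1 * (4 * gamma * risk alpha +oo%E (Theta n)) @[n --> \oo] -->
      (4 * gamma)^-1 * 0.
    by apply: cvgM => //; exact: cvg_cst.
  by under eq_fun do rewrite mulKf ?gt_eqF//; rewrite mulr0.
have risk0E : (risk alpha +oo%E (Theta n))%:E @[n --> \oo] --> 0%E.
  by apply/fine_cvgP; split; [exact: nearW|exact: risk0].
rewrite is_cvg_limn_esupE; last exact: cvgP risk0E.
exact: cvg_lim.
Qed.
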